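(* Let $X$ be a metrizable space and let $\mathcal{S}$ be a bornology on $X$. Suppose $d,\rho$ are two compatible metrics on $X$. Then the following statements are equivalent: (i) $\tau_{\mathcal{S},d}^+ \supseteq \tau_{\mathcal{S},\rho}^+$ on $CL(X)$; (ii) for each $S\in\mathcal{S}$ and $f,g\in\mathcal{Z}^+$ such that $\inf\{g(x)-f(x):x\in S\}>0$ and $B_\rho(S,g)\neq X$, the set $B_\rho(S,f)$ is strict variationally $(\mathcal{S}$-$d)$ included in $B_\rho(S,g)$; (iii) for each pair $(A,C)$ of nonempty proper subsets of $X$ such that $A$ is strict variationally $(\mathcal{S}$-$\rho)$ included in $C$, $A$ is strict variationally $(\mathcal{S}$-$d)$ included in $C$.
   Context: All metric (metrizable) spaces have at least two points. A bornology on $X$ is a family of nonempty subsets of $X$ that covers $X$, is closed under finite unions, and is closed under taking nonempty subsets of its members. $CL(X)$ is the set of nonempty closed subsets of $X$. $\mathcal{Z}^+$ is the set of all functions $f:X\to\mathbb{R}$ with $f(x)>0$ for all $x\in X$. For a compatible metric $d$, a nonempty $S\subseteq X$ and $f\in\mathcal{Z}^+$, $B_d(S,f)=\{x\in X: d(x,s)<f(s)\text{ for some }s\in S\}$. The topology $\tau_{\mathcal{S},d}^+$ on $CL(X)$ has as neighborhood base at $A$ the sets $\{C\in CL(X): d(x,A)-d(x,C)<\epsilon\ \forall x\in S\}$, $S\in\mathcal{S}$, $\epsilon>0$, where $d(x,A)=\inf\{d(x,a):a\in A\}$. For nonempty $A\subseteq C\subseteq X$, $A$ is strict variationally $(\mathcal{S}$-$d)$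 included in $C$ if there exist $S\in\mathcal{S}$ and $f,g\in\mathcal{Z}^+$ with $\inf_{x\in S}(g(x)-f(x))>0$ such that $A\subseteq B_d(S,f)\subseteq B_d(S,g)\subseteq C$. The same notions are used with $\rho$ in place of $d$. *)

(* Defs.v *)
From HB Require Import structures.
From mathcomp Require Import all_boot all_order all_algebra.
From mathcomp Require Import all_classical all_reals all_analysis.
From mathcomp Require Import lra.

Set Implicit Arguments.
Unset Strict Implicit.
Unset Printing Implicit Defensive.

Import Order.TTheory GRing.Theory Num.Theory.
Import numFieldNormedType.Exports.

Local Open Scope classical_set_scope.
Local Open Scope ring_scope.

Section Definitions.
Context {R : realType} {X : topologicalType}.
Implicit Types (d : X -> X -> R) (S A C : set X) (SS : set (set X)).

(* Two metrics on one and the same space have to be compared, so a metric is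
   a plain function rather than the canonical distance of a [metricType]. *)
Definition is_metric d : Prop :=
  [/\ forall x y, 0 <= d x y,
      forall x y, d x y = 0 <-> x = y,
      forall x y, d x y = d y x &
      forall x y z, d x z <= d x y + d y z].

Definition compatible_metric d : Prop :=
  is_metric d /\
  forall U : set X, open U <->
    forall x, U x -> exists2 e : R, 0 < e & [set y | d x y < e] `<=` U.

Definition bornology SS : Prop :=
  [/\ forall S, SS S -> S !=set0,
      forall x, exists2 S, SS S & S x,
      forall S T, SS S -> SS T -> SS (S `|` T) &
      forall S T, SS S -> T !=set0 -> T `<=` S -> SS T].

Definition CL : set (set X) := [set A | closed A /\ A !=set0].

Definition Zplus : set (X -> R) := [set f | forall x, 0 < f x].

Definition enlargement d S (f : X -> R) : set X :=
  [set x | exists2 s, S s & d x s < f s].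

Definition dist d (x : X) A : R := inf [set d x a | a in A].

Definition tau_plus_nbhd d A S (e : R) : set (set X) :=
  [set C | CL C /\ forall x, S x -> dist d x A - dist d x C < e].

(* The topology itself, as the family of its open subsets of [CL]. *)
Definition tau_plus SS d : set (set (set X)) :=
  [set U | U `<=` CL /\
    forall A, U A -> exists S, exists2 e : R,
      SS S /\ 0 < e & tau_plus_nbhd d A S e `<=` U].

(* The infimum is taken in the extended reals because [g - f] may be
   unbounded below on [S]. *)
Definition strict_gap S (f g : X -> R) : Prop :=
  (0 < ereal_inf [set (g x - f x)%:E | x in S])%E.

Definition strict_var_included SS d A C : Prop :=
  exists S, exists f, exists g,
    [/\ SS S, Zplus f, Zplus g & strict_gap S f g] /\
    [/\ A `<=` enlargement d S f,
        enlargement d S f `<=` enlargement d S g &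
        enlargement d S g `<=` C].

(* The sets [tau_plus_nbhd d A S e] form a neighborhood base of [tau_plus] at
   [A], although they need not be open themselves. *)
Lemma tau_plus_nbhd_base SS d A (V : set (set X)) : CL A -> V `<=` CL ->
  (exists U, [/\ tau_plus SS d U, U A & U `<=` V]) <->
  (exists S, exists2 e : R, SS S /\ 0 < e & tau_plus_nbhd d A S e `<=` V).
Proof.
move=> clA VCL; split=> [[U [[_ oU] UA UV]]|[S [e Se NV]]].
  have [S [e Se NU]] := oU _ UA.
  by exists S, e => //; exact: subset_trans UV.
exists [set B | CL B /\ exists S, exists2 e : R,
          SS S /\ 0 < e & tau_plus_nbhd d B S e `<=` V]; split.
- split=> [B []//|B [clB [T [r [ST r0] NBV]]]].
  exists T, (r / 2); first by split=> //; rewrite divr_gt0.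
  move=> C [clC BC]; split=> //; exists T, (r / 2).
    by split=> //; rewrite divr_gt0.
  move=> D [clD CD]; apply: NBV; split=> // x Tx.
  have := BC x Tx; have := CD x Tx; lra.
- by split=> //; exists S, e.
- move=> B [clB [T [r [ST r0] NBV]]]; apply: NBV; split=> // x _.
  by rewrite subrr.
Qed.

End Definitions.

Arguments CL X : clear implicits.

(* Main.v *)
(* The basic neighborhoods of [A] and strict inclusions in [~` A] encode each
   other. If [C] fails to lie in the neighborhood of [A] given by [S] and [e],
   some [c] in [C] and [s] in [S] satisfy [d s c < dist d s A - e / 2], so [C]
   meets the enlargement of [S] by [dist d s A - e / 2], whereas the enlargement
   by [dist d s A] misses [A]. Hence a strict inclusion between these two
   enlargements turns into an inclusion of neighborhoods; conversely an
   inclusion of neighborhoods of the complement [A] of [enlargement rho S g],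
   tested on singletons, gives the strict inclusion. *)
Require Import Defs.
From HB Require Import structures.
From mathcomp Require Import all_boot all_order all_algebra.
From mathcomp Require Import all_classical all_reals all_analysis.
From mathcomp Require Import lra.

Import Order.TTheory GRing.Theory Num.Theory.

Local Open Scope classical_set_scope.
Local Open Scope ring_scope.

Section Distance.
Context {R : realType} {X : topologicalType}.
Implicit Types (d rho : X -> X -> R) (A C S T : set X) (SS : set (set X)).
Implicit Types (x : X) (e r : R) (f g : X -> R).

Lemma dist_le d A x a : is_metric d -> A a -> dist d x A <= d x a.
Proof.
move=> [d0 _ _ _] Aa; apply: ge_inf; last by exists a.
by exists 0 => _ [b _ <-].
Qed.

Lemma dist_ge d A x r :
  A !=set0 -> (forall a, A a -> r <= d x a) -> r <= dist d x A.
Proof.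
move=> [a Aa] rA; apply: lb_le_inf; first by exists (d x a), a.
by move=> _ [b Ab <-]; exact: rA.
Qed.

Lemma dist_ge0 d A x : is_metric d -> A !=set0 -> 0 <= dist d x A.
Proof. by move=> [d0 _ _ _] A0; apply: dist_ge. Qed.

Lemma dist_lt d A x r :
  A !=set0 -> dist d x A < r -> exists2 a, A a & d x a < r.
Proof.
move=> A0; apply: contraPP => nA; apply/negP; rewrite -leNgt.
apply: dist_ge => // a Aa; rewrite leNgt; apply/negP => da.
by apply: nA; exists a.
Qed.

Lemma dist_set1 d x y : dist d x [set y] = d x y.
Proof. by rewrite /dist image_set1 inf1. Qed.

(** This makes singletons available as elements of [CL X]: the ball around [y] of radius [d y x]
    misses [x]. *)
Lemma compatible_metric_closed1 d x :
  compatible_metric d -> closed [set x].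
Proof.
move=> [[d0 deq dC dT] dopen]; rewrite -openC; apply/dopen => y /= yx.
exists (d y x) => [|z /= + zx]; last by rewrite zx ltxx.
by rewrite lt_neqAle d0 andbT eq_sym; apply/eqP => /deq.
Qed.

Lemma open_enlargement d S f : compatible_metric d -> open (enlargement d S f).
Proof.
move=> [[d0 deq dC dT] dopen]; apply/dopen => y [s Ss dys].
exists (f s - d y s); first by rewrite subr_gt0.
move=> z /= yz; exists s => //; have := dT z y s; rewrite (dC z y); lra.
Qed.

Lemma enlargement_neq0 d S f :
  is_metric d -> Zplus f -> S !=set0 -> enlargement d S f !=set0.
Proof.
by move=> [_ deq _ _] f0 [s Ss]; exists s, s => //; rewrite (deq s s).2.
Qed.

(** A real infimum serves as [e] itself; the value +oo forces [S] to be empty, so that any [e]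
    works, and -oo contradicts the gap. *)
Lemma strict_gapP S f g :
  strict_gap S f g <-> exists2 e, 0 < e & forall x, S x -> e <= g x - f x.
Proof.
rewrite /strict_gap; split=> [gap|[e e0 efg]]; last first.
  apply: (@lt_le_trans _ _ e%:E); first by rewrite lte_fin.
  by apply: le_ereal_inf_tmp => _ [x Sx <-]; rewrite lee_fin efg.
have inf_le x : S x -> (ereal_inf [set (g y - f y)%:E | y in S] <=
    (g x - f x)%:E)%E.
  by move=> Sx; apply: ereal_inf_lbound; exists x.
move: gap inf_le; case: (ereal_inf _) => [e||] //.
- by rewrite lte_fin => e0 efg; exists e => // x /efg.
- by move=> _ noS; exists 1 => // x /noS.
Qed.

Lemma enlargement_gap d S f g :
  strict_gap S f g -> enlargement d S f `<=` enlargement d S g.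
Proof.
move=> /strict_gapP[e e0 efg] x [s Ss xs]; exists s => //.
have := efg s Ss; lra.
Qed.

Lemma enlargement_dist d A S g x : is_metric d ->
  (forall s, S s -> g s <= dist d s A) -> enlargement d S g x -> ~ A x.
Proof.
move=> md gA [s Ss xs] Ax; have [_ _ dC _] := md.
have := dist_le _ _ s _ md Ax; have := gA s Ss; rewrite (dC s x); lra.
Qed.

Lemma dist_enlargement d A S g s : is_metric d -> A !=set0 ->
  enlargement d S g `<=` ~` A -> S s -> g s <= dist d s A.
Proof.
move=> [_ _ dC _] A0 gA Ss; apply: dist_ge => // a Aa; rewrite leNgt.
by apply/negP => sa; apply: (gA a) => //; exists s => //; rewrite dC.
Qed.

Lemma strict_var_included_sub SS d A A' C C' : A `<=` A' -> C' `<=` C ->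
  strict_var_included SS d A' C' -> strict_var_included SS d A C.
Proof.
move=> AA' CC' [S [f [g [H [A'f fg gC']]]]].
exists S, f, g; split=> //; split=> //; first exact: subset_trans A'f.
exact: subset_trans CC'.
Qed.

(** A basic [rho]-neighborhood need not be open, but by [tau_plus_nbhd_base] it contains a
    [rho]-open set around [A]; that set is [d]-open, so it contains a basic [d]-neighborhood. *)
Lemma tau_plus_subP SS d rho : tau_plus SS rho `<=` tau_plus SS d <->
  forall A S e, CL X A -> SS S -> 0 < e -> exists T, exists2 r,
    SS T /\ 0 < r & tau_plus_nbhd d A T r `<=` tau_plus_nbhd rho A S e.
Proof.
split=> [sub A S e clA SSS e0|sub U [UCL oU]].
  have nCL : tau_plus_nbhd rho A S e `<=` CL X by move=> C [].
  apply/(tau_plus_nbhd_base SS d clA nCL).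
  have [|U [oU UA Un]] := (tau_plus_nbhd_base SS rho clA nCL).2.
    by exists S, e.
  by exists U; split=> //; exact: sub.
split=> // A UA; have [S [e [SSS e0] nU]] := oU A UA.
have [T [r [SST r0] dn]] := sub A S e (UCL _ UA) SSS e0.
by exists T, r => //; exact: subset_trans nU.
Qed.

Lemma tau_plus_nbhd_strict_var_included SS d rho S T f g e r :
  bornology SS -> compatible_metric d -> compatible_metric rho ->
  SS S -> SS T -> 0 < r -> Zplus f ->
  (forall s, S s -> e <= g s - f s) ->
  enlargement rho S g <> [set: X] ->
  tau_plus_nbhd d (~` enlargement rho S g) T r `<=`
    tau_plus_nbhd rho (~` enlargement rho S g) S e ->
  strict_var_included SS d (enlargement rho S f) (enlargement rho S g).
Proof.
move=> [SS0 _ _ SSsub] cd crho SSS SST r0 f0 efg gX.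
set A := ~` _ => nbhd_sub.
have [md _] := cd; have [mrho _] := crho.
have [_ _ dC _] := md; have [_ _ rhoC _] := mrho.
have A0 : A !=set0 by move/eqP/setTPn: gX.
have gA s : S s -> g s <= dist rho s A.
  by apply: dist_enlargement => //; rewrite setCK.
(* At [s] the drop [dist rho s A - rho s x] exceeds [g s - f s >= e], so [[set x]] is outside the
   [rho]-neighborhood, hence outside the [d]-neighborhood. *)
have far x : enlargement rho S f x ->
    exists2 t, T t & r <= dist d t A - d t x.
  move=> [s Ss xs]; apply: contrapT => near_x.
  have CL1 : CL X [set x].
    by split; [exact: compatible_metric_closed1 cd|exists x].
  have /nbhd_sub[_ /(_ s Ss)] : tau_plus_nbhd d A T r [set x].
    split=> // t Tt; rewrite dist_set1 ltNge; apply/negP => rt.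
    by apply: near_x; exists t.
  rewrite dist_set1 rhoC; have := gA s Ss; have := efg s Ss; lra.
(* Since [d t x >= 0], every witness from [far] lies in [T'], and there [dist d t A - r / 2] is a
   positive radius. *)
pose T' := [set t | T t /\ r <= dist d t A].
have T'far x : enlargement rho S f x ->
    exists2 t, T' t & r <= dist d t A - d t x.
  move=> /far[t Tt rt]; exists t => //; split=> //.
  by have [d0 _ _ _] := md; have := d0 t x; lra.
have T'0 : T' !=set0.
  have [x /T'far[t T't _]] := enlargement_neq0 rho S f mrho f0 (SS0 S SSS).
  by exists t.
(* The maxima only make the radii positive outside [T']. *)
pose f' t := Num.max (r / 2) (dist d t A - r / 2).
pose g' t := Num.max (r / 2) (dist d t A).
have f'E t : T' t -> f' t = dist d t A - r / 2.
  by move=> [_ rt]; apply/max_idPr; lra.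
have g'E t : T' t -> g' t = dist d t A.
  by move=> [_ rt]; apply/max_idPr; lra.
have gap : strict_gap T' f' g'.
  apply/strict_gapP; exists (r / 2) => [|t T't]; first by rewrite divr_gt0.
  by rewrite f'E // g'E //; lra.
exists T', f', g'; split; split.
- by apply: (SSsub T) => // t [].
- by move=> t; rewrite lt_max divr_gt0.
- by move=> t; rewrite lt_max divr_gt0.
- by [].
- move=> x /T'far[t T't rt]; exists t => //.
  by rewrite f'E // dC; lra.
- exact: enlargement_gap.
- move=> x g'x; apply: contrapT.
  by apply: (enlargement_dist d A T' g' x) => // t /g'E ->.
Qed.

Lemma strict_var_included_tau_plus_nbhd SS d rho A S e :
  is_metric d -> is_metric rho -> CL X A -> 0 < e ->
  let f s := Num.max (e / 2) (dist rho s A - e / 2) in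
  let S' := [set s | S s /\ e <= dist rho s A] in
  strict_var_included SS d (enlargement rho S' f) (~` A) ->
  exists T, exists2 r, SS T /\ 0 < r &
    tau_plus_nbhd d A T r `<=` tau_plus_nbhd rho A S e.
Proof.
move=> md mrho [_ A0] e0 f S' [T [f' [g' [[SST _ _ /strict_gapP[r r0 rfg]]]]]].
have [_ _ dC _] := md; have [_ _ rhoC _] := mrho.
move=> [ff' _ g'A]; exists T, r => // C [clC Cd]; split=> // s Ss.
have [_ C0] := clC; rewrite ltNge; apply/negP => es.
(* This bound puts [s] in [S']. Giving up only [e / 2] leaves room for a point [c] of [C] that
   nearly attains the infimum. *)
have rho0 := dist_ge0 rho C s mrho C0.
have [|c Cc sc] := dist_lt rho C s (dist rho s A - e / 2) C0; first by lra.
have /ff'[t Tt ct] : enlargement rho S' f c.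
  exists s; first by split=> //; lra.
  by rewrite lt_max (rhoC c s) sc orbT.
(* Here [dist d t C < f' t] and [g' t <= dist d t A], so the drop at [t] exceeds the gap [r],
   against [Cd]. *)
have := Cd t Tt; have := dist_le d C t c md Cc; rewrite (dC t c).
have := dist_enlargement d A T g' t md A0 g'A Tt; have := rfg t Tt; lra.
Qed.

End Distance.

Theorem theorem4p1 (R : realType) (X : topologicalType)
  (X2 : exists x y : X, x <> y)
  (SS : set (set X)) (bornSS : bornology SS)
  (d rho : X -> X -> R)
  (d_comp : compatible_metric d) (rho_comp : compatible_metric rho) :
  let i := tau_plus SS rho `<=` tau_plus SS d in
  let ii := forall (S : set X) (f g : X -> R),
    SS S -> Zplus f -> Zplus g -> strict_gap S f g ->
    enlargement rho S g <> [set: X] ->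
    strict_var_included SS d (enlargement rho S f) (enlargement rho S g) in
  let iii := forall A C : set X,
    A !=set0 -> A <> [set: X] -> C !=set0 -> C <> [set: X] ->
    strict_var_included SS rho A C -> strict_var_included SS d A C in
  (i <-> ii) /\ (ii <-> iii).
Proof.
move=> i ii iii; have [SS0 _ _ SSsub] := bornSS.
have [md _] := d_comp; have [mrho _] := rho_comp.
split; split.
- move=> /tau_plus_subP sub S f g SSS f0 g0 /strict_gapP[e e0 efg] gX.
  have clA : CL X (~` enlargement rho S g).
    split; first by exact/open_closedC/open_enlargement.
    by move/eqP/setTPn: gX.
  have [T [r [SST r0]]] := sub _ S e clA SSS e0.
  exact: tau_plus_nbhd_strict_var_included.
- move=> hii; apply/tau_plus_subP => A S e clA SSS e0.
  have [_ [a Aa]] := clA.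
  pose S' := [set s | S s /\ e <= dist rho s A].
  (* The empty set is not in the bornology. If [S'] is empty, no drop on [S] can reach [e], so any
     basic neighborhood of [A] will do. *)
  have [S'0|/set0P S'0] := eqVneq S' set0.
    exists S, 1 => // C [clC _]; split=> // s Ss.
    have := dist_ge0 rho C s mrho clC.2.
    rewrite ltNge => rho0; apply/negP => es.
    by have : S' s; [split=> //; lra|rewrite S'0].
  apply: (strict_var_included_tau_plus_nbhd SS d rho A S e) => //=.
  (* On [S'] both maxima are their second arguments, which gives the gap [e / 2]; elsewhere they
     only keep the radii positive. *)
  pose f s := Num.max (e / 2) (dist rho s A - e / 2).
  pose g s := Num.max (e / 2) (dist rho s A).
  have gE s : S' s -> g s = dist rho s A.
    by move=> [_ es]; apply/max_idPr; lra.
  have gA : enlargement rho S' g `<=` ~` A.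
    by move=> x; apply: enlargement_dist => // s /gE ->.
  apply: (strict_var_included_sub _ _ _ _ _ _ (@subset_refl _ _) gA).
  apply: hii.
  + by apply: (SSsub S) => // s [].
  + by move=> s; rewrite lt_max divr_gt0.
  + by move=> s; rewrite lt_max divr_gt0.
  + apply/strict_gapP; exists (e / 2) => [|s S's]; first by rewrite divr_gt0.
    rewrite gE //; have [_ es] := S's.
    have /max_idPr-> : e / 2 <= dist rho s A - e / 2 by lra.
    lra.
  + by move=> gX; apply: (gA a) => //; rewrite gX.
- move=> hii A C _ _ _ CX [S [f [g [[SSS f0 g0 gap] [Af _ gC]]]]].
  (* The enlargements witnessing the [rho]-inclusion lie between [A] and [C], so (ii) for them
     suffices; the larger one is proper because [C] is. *)
  apply: (strict_var_included_sub _ _ _ _ _ _ Af gC); apply: hii => //.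
  by move=> gX; apply: CX; apply/seteqP; split=> // x _; apply: gC; rewrite gX.
- move=> hiii S f g SSS f0 g0 gap gX.
  have fg := enlargement_gap rho S f g gap.
  apply: hiii => //.
  + by apply: enlargement_neq0 => //; exact: SS0.
  + move=> fX; apply: gX; apply/seteqP.
    by split=> // x _; apply: fg; rewrite fX.
  + by apply: enlargement_neq0 => //; exact: SS0.
  + by exists S, f, g; split; split=> //; exact: subset_refl.
Qed.
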